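(* If the differentiable $B$-$A$ bimodule $(M,\check\nabla,\check\sigma)$ is flat, then the functor $(M,\check\nabla,\check\sigma)_*:{}_A\mathcal{E}\to{}_B\mathcal{E}$ restricts to a functor from ${}_A\mathcal{F}$ to ${}_B\mathcal{F}$.
   Context: Algebras are unital over a field $k$. A differential calculus on $A$ is a differential graded algebra $(\mathrm{d},\Omega^*A)$ with $\Omega^0A=A$ and product $\wedge$; $A$ and $B$ are algebras with differential calculi. A connection on a left $A$-module $E$ is a linear map $\nabla:E\to\Omega^1A\otimes_AE$ with $\nabla(a.e)=\mathrm{d}a\otimes e+a\nabla e$; it is flat if $\nabla^{[1]}\nabla=0$, where $\nabla^{[1]}(\omega\otimes e)=\mathrm{d}\omega\otimes e-\omega\wedge\nabla e$. ${}_A\mathcal{E}$ is the category of left $A$-modules with connection; its morphisms are the left $A$-module maps $\phi$ with $\nabla\circ\phi=(\mathrm{id}\otimes\phi)\circ\nabla$. ${}_A\mathcal{F}$ is the full subcategory of flat ones. A differentiable $B$-$A$ bimodule is a $B$-$A$ bimodule $M$ with a left $B$-connection $\check\nabla:M\to\Omega^1B\otimes_BM$ and a $B$-$A$ bimodule map $\check\sigma:M\otimes_A\Omega^1A\to\Omega^1B\otimes_BM$ such that $\check\nabla(m.a)=\check\nabla(m).a+\check\sigma(m\otimes\mathrm{d}a)$ for all $m\in M$, $a\in A$. It is flat if there is a $B$-$A$ bimodule map, also denoted $\check\sigma:M\otimes_A\Omega^2A\to\Omega^2B\otimes_BM$, such that (a) $\check\nabla$ is flat as a left $B$-connection on $M$;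 (b) $(\mathrm{id}\wedge\check\sigma)(\check\sigma\otimes\mathrm{id})=\check\sigma(\mathrm{id}\otimes\wedge):M\otimes_A\Omega^1A\otimes_A\Omega^1A\to\Omega^2B\otimes_BM$. The functor $(M,\check\nabla,\check\sigma)_*$ sends $(E,\nabla)$ to $(M\otimes_AE,\hat\nabla)$ with $\hat\nabla(m\otimes e)=\check\nabla m\otimes e+(\check\sigma\otimes\mathrm{id})(m\otimes\nabla e)$, and a morphism $\phi$ to $\mathrm{id}\otimes\phi$.
   Formalization: The formal theorem additionally assumes that every 1-form on A is a finite sum of forms a.db (Ω¹A = A.dA), the usual convention for differential calculi; without it the statement as given is false. *)

(* Defs.v *)
From HB Require Import structures.
From mathcomp Require Import all_boot all_order all_algebra generic_quotient.
From mathcomp Require Import boolp.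

Set Implicit Arguments.
Unset Strict Implicit.
Unset Printing Implicit Defensive.

Import GRing.Theory.
Local Open Scope ring_scope.
Local Open Scope quotient_scope.

Reserved Notation "M ⊗ E" (at level 40, left associativity).
Reserved Notation "m *:> a" (at level 40, left associativity).

HB.mixin Record Lmodule_isBimodule (k : fieldType) (B A : algType k) M
    of GRing.Lmodule B M := {
  rscale : M -> A -> M;
  rscaleDl : forall (m n : M) (a : A), rscale (m + n) a = rscale m a + rscale n a;
  rscaleDr : forall (m : M) (a b : A), rscale m (a + b) = rscale m a + rscale m b;
  rscaleA : forall (m : M) (a b : A), rscale m (a * b) = rscale (rscale m a) b;
  rscale1 : forall m : M, rscale m 1 = m;
  rscaleAl : forall (b : B) (m : M) (a : A), rscale (b *: m) a = b *: rscale m a;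
  scale_central : forall (c : k) (m : M), (c%:A : B) *: m = rscale m c%:A
}.

#[short(type="bimodType")]
HB.structure Definition Bimodule (k : fieldType) (B A : algType k) :=
  {M of GRing.Lmodule B M & Lmodule_isBimodule k B A M}.

Notation "m *:> a" := (rscale m a) : ring_scope.

Definition bimod_map (k : fieldType) (B A : algType k) (M N : bimodType B A)
    (f : M -> N) : Prop :=
  [/\ {morph f : x y / x + y},
      forall (b : B) x, f (b *: x) = b *: f x &
      forall x (a : A), f (x *:> a) = f x *:> a].

Section Regular.
Variables (k : fieldType) (A : algType k).

Fact reg_rscale_central (c : k) (m : A^o) :
  (c%:A : A) *: m = (m : A) * c%:A.
Proof. by rewrite /GRing.scale/= mulr_algl mulr_algr. Qed.

HB.instance Definition _ := Lmodule_isBimodule.Build k A A A^o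
  (@mulrDl A) (@mulrDr A) (@mulrA A) (@mulr1 A)
  (fun b m a => esym (mulrA b m a)) reg_rscale_central.
End Regular.

Section Tensor.
Variables (k : fieldType) (B A : algType k) (M : bimodType B A) (E : lmodType A).

Definition balanced (V : zmodType) (f : M -> E -> V) : Prop :=
  [/\ forall e, {morph f^~ e : x y / x + y},
      forall m, {morph f m : x y / x + y} &
      forall m (a : A) e, f (m *:> a) e = f m (a *: e)].

Definition fsum (V : zmodType) (f : M -> E -> V) (s : seq (M * E)) : V :=
  \sum_(p <- s) f p.1 p.2.

(* s stands for the formal sum of the m ⊗ e over (m, e) in s; two formal sums are
   identified when every balanced map takes the same value on them. *)
Definition tens_eq (s t : seq (M * E)) : bool :=
  `[< forall (V : zmodType) (f : M -> E -> V),
        balanced f -> fsum f s = fsum f t >].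

Fact tens_eq_refl : reflexive tens_eq.
Proof. by move=> s; apply/asboolP. Qed.
Fact tens_eq_sym : symmetric tens_eq.
Proof. by move=> s t; apply/asboolP/asboolP => h V f fb; rewrite h. Qed.
Fact tens_eq_trans : transitive tens_eq.
Proof.
move=> t s u /asboolP h1 /asboolP h2; apply/asboolP => V f fb.
by rewrite h1 ?h2.
Qed.
Canonical tens_eq_equiv :=
  EquivRel tens_eq tens_eq_refl tens_eq_sym tens_eq_trans.

Definition tens := {eq_quot tens_eq}.
HB.instance Definition _ := Choice.on tens.

Definition tmk (s : seq (M * E)) : tens := \pi_tens s.
Definition tpure (m : M) (e : E) : tens := tmk [:: (m, e)].

(* Only meaningful for balanced f: otherwise the value depends on the choice
   of the representative; see tlift_pure, tliftD and tens_ext. *)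
Definition tlift (V : zmodType) (f : M -> E -> V) (x : tens) : V :=
  fsum f (repr x).

Lemma fsum_cat (V : zmodType) (f : M -> E -> V) s t :
  fsum f (s ++ t) = fsum f s + fsum f t.
Proof. exact: big_cat. Qed.

Lemma tlift_mk (V : zmodType) (f : M -> E -> V) s :
  balanced f -> tlift f (tmk s) = fsum f s.
Proof.
move=> fb; have /eqquotP/asboolP h : tmk s = \pi_tens (repr (tmk s)).
  by rewrite reprK.
by rewrite /tlift -h.
Qed.

Lemma tlift_pure (V : zmodType) (f : M -> E -> V) m e :
  balanced f -> tlift f (tpure m e) = f m e.
Proof. by move=> fb; rewrite tlift_mk // /fsum big_seq1. Qed.

Lemma tlift_eq (x y : tens) :
  (forall (V : zmodType) (f : M -> E -> V), balanced f -> tlift f x = tlift f y) ->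
  x = y.
Proof.
move=> h; rewrite -[x]reprK -[y]reprK; apply/eqquotP/asboolP => V f fb.
exact: h.
Qed.

Definition tzero : tens := tmk [::].
Definition topp (x : tens) : tens := tmk [seq (- p.1, p.2) | p <- repr x].
Definition tadd (x y : tens) : tens := tmk (repr x ++ repr y).
Definition tscale (b : B) (x : tens) : tens :=
  tmk [seq (b *: p.1, p.2) | p <- repr x].

Lemma balanced0l (V : zmodType) (f : M -> E -> V) e : balanced f -> f 0 e = 0.
Proof. by case=> h _ _; apply: (addIr (f 0 e)); rewrite -h !add0r. Qed.
Lemma balancedNl (V : zmodType) (f : M -> E -> V) m e :
  balanced f -> f (- m) e = - f m e.
Proof.
move=> fb; case: (fb) => h _ _.
by apply: (addIr (f m e)); rewrite -h !addNr balanced0l.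
Qed.

Fact tlift_zero (V : zmodType) (f : M -> E -> V) :
  balanced f -> tlift f tzero = 0.
Proof. by move=> fb; rewrite tlift_mk // /fsum big_nil. Qed.
Fact tlift_add (V : zmodType) (f : M -> E -> V) x y :
  balanced f -> tlift f (tadd x y) = tlift f x + tlift f y.
Proof. by move=> fb; rewrite tlift_mk // fsum_cat. Qed.
Fact tlift_opp (V : zmodType) (f : M -> E -> V) x :
  balanced f -> tlift f (topp x) = - tlift f x.
Proof.
move=> fb; rewrite tlift_mk // /fsum big_map /tlift /fsum -sumrN.
by apply: eq_bigr => p _; rewrite balancedNl.
Qed.
Fact tlift_scale (V : zmodType) (f : M -> E -> V) b x :
  balanced f -> tlift f (tscale b x) = tlift (fun m e => f (b *: m) e) x.
Proof. by move=> fb; rewrite tlift_mk // /fsum big_map. Qed.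
Fact balanced_scale (V : zmodType) (f : M -> E -> V) b :
  balanced f -> balanced (fun m e => f (b *: m) e).
Proof.
case=> f1 f2 f3; split=> [e x y|m x y|m a e].
- by rewrite scalerDr f1.
- exact: f2.
- by rewrite -rscaleAl f3.
Qed.

Fact taddA : associative tadd.
Proof. by move=> x y z; apply: tlift_eq => V f fb; rewrite !tlift_add // addrA. Qed.
Fact taddC : commutative tadd.
Proof. by move=> x y; apply: tlift_eq => V f fb; rewrite !tlift_add // addrC. Qed.
Fact tadd0 : left_id tzero tadd.
Proof.
by move=> x; apply: tlift_eq => V f fb; rewrite tlift_add // tlift_zero // add0r.
Qed.
Fact taddN : left_inverse tzero topp tadd.
Proof.
move=> x; apply: tlift_eq => V f fb.
by rewrite tlift_add // tlift_opp // tlift_zero // addNr.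
Qed.
HB.instance Definition _ := GRing.isZmodule.Build tens taddA taddC tadd0 taddN.

Fact tscaleA a b x : tscale a (tscale b x) = tscale (a * b) x.
Proof.
apply: tlift_eq => V f fb; rewrite !tlift_scale //; last exact: balanced_scale.
by apply: eq_bigr => p _; rewrite scalerA.
Qed.
Fact tscale1 : left_id 1 tscale.
Proof.
move=> x; apply: tlift_eq => V f fb; rewrite tlift_scale //.
by apply: eq_bigr => p _; rewrite scale1r.
Qed.
Fact tscaleDr : right_distributive tscale +%R.
Proof.
move=> b x y; apply: tlift_eq => V f fb.
by rewrite !(tlift_scale, tlift_add) //; exact: balanced_scale.
Qed.
Fact tscaleDl x : {morph tscale^~ x : a b / a + b}.
Proof.
move=> a b; apply: tlift_eq => V f fb.
rewrite !(tlift_scale, tlift_add) // /tlift /fsum -big_split /=.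
by apply: eq_bigr => p _; rewrite scalerDl; case: fb => ->.
Qed.
HB.instance Definition _ :=
  GRing.Zmodule_isLmodule.Build B tens tscaleA tscale1 tscaleDr tscaleDl.

Lemma tliftD (V : zmodType) (f : M -> E -> V) :
  balanced f -> {morph tlift f : x y / x + y}.
Proof. by move=> fb x y; rewrite tlift_add. Qed.

Lemma balanced_pure : balanced tpure.
Proof.
split=> [e x y|m x y|m a e]; apply: tlift_eq => V f fb;
  rewrite ?tliftD // !tlift_pure //; case: fb => f1 f2 f3; [exact: f1|exact: f2|exact: f3].
Qed.

Lemma tpureDl e : {morph tpure^~ e : m n / m + n}.
Proof. by case: balanced_pure. Qed.
Lemma tpureDr m : {morph tpure m : e f / e + f}.
Proof. by case: balanced_pure. Qed.
Lemma tpureA m a e : tpure (m *:> a) e = tpure m (a *: e).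
Proof. by case: balanced_pure. Qed.
Lemma scale_pure b m e : b *: tpure m e = tpure (b *: m) e.
Proof.
apply: tlift_eq => V f fb; rewrite tlift_scale // !tlift_pure //.
exact: balanced_scale.
Qed.

Lemma morphD0 (U V : zmodType) (f : U -> V) :
  {morph f : x y / x + y} -> f 0 = 0.
Proof. by move=> h; apply: (addIr (f 0)); rewrite -h !add0r. Qed.
Lemma morphDN (U V : zmodType) (f : U -> V) :
  {morph f : x y / x + y} -> {morph f : x / - x}.
Proof.
by move=> h x; apply: (addIr (f x)); rewrite -h !addNr morphD0.
Qed.

Lemma tens_sum (x : tens) : x = \sum_(p <- repr x) tpure p.1 p.2.
Proof.
apply: tlift_eq => V f fb; have h := tliftD fb; have h0 := morphD0 h.
rewrite (big_morph _ h h0) {1}/tlift /fsum.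
by apply: eq_bigr => p _; rewrite tlift_pure.
Qed.

Lemma tens_ext (V : zmodType) (f g : tens -> V) :
  {morph f : x y / x + y} -> {morph g : x y / x + y} ->
  (forall m e, f (tpure m e) = g (tpure m e)) -> f =1 g.
Proof.
move=> fD gD h x; rewrite [x]tens_sum.
rewrite (big_morph _ fD (morphD0 fD)) (big_morph _ gD (morphD0 gD)).
by apply: eq_bigr.
Qed.
End Tensor.

Notation "M ⊗ E" := (tens M E) : type_scope.

Section TensorMap.
Variables (k : fieldType) (B A C : algType k).

Definition tmap (B' : algType k) (M : bimodType B A) (M' : bimodType B' A)
    (E E' : lmodType A) (f : M -> M') (g : E -> E') : M ⊗ E -> M' ⊗ E' :=
  tlift (fun m e => tpure (f m) (g e)).

Definition rlin (B' : algType k) (M : bimodType B A) (M' : bimodType B' A)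
    (f : M -> M') : Prop :=
  {morph f : x y / x + y} /\ forall x (a : A), f (x *:> a) = f x *:> a.
Definition llin (E E' : lmodType A) (g : E -> E') : Prop :=
  {morph g : x y / x + y} /\ forall (a : A) x, g (a *: x) = a *: g x.

Lemma balanced_tmap (B' : algType k) (M : bimodType B A) (M' : bimodType B' A)
    (E E' : lmodType A) (f : M -> M') (g : E -> E') : rlin f -> llin g ->
  balanced (fun m e => tpure (f m) (g e)).
Proof.
move=> [f1 f2] [g1 g2]; split=> [e x y|m x y|m a e].
- by rewrite f1 tpureDl.
- by rewrite g1 tpureDr.
- by rewrite f2 g2 tpureA.
Qed.
Lemma tmapD (B' : algType k) (M : bimodType B A) (M' : bimodType B' A)
    (E E' : lmodType A) (f : M -> M') (g : E -> E') : rlin f -> llin g ->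
  {morph tmap f g : x y / x + y}.
Proof. by move=> hf hg; apply: tliftD; exact: balanced_tmap. Qed.
Lemma tmap_pure (B' : algType k) (M : bimodType B A) (M' : bimodType B' A)
    (E E' : lmodType A) (f : M -> M') (g : E -> E') m e : rlin f -> llin g ->
  tmap f g (tpure m e) = tpure (f m) (g e).
Proof. by move=> hf hg; rewrite [LHS]tlift_pure //; exact: balanced_tmap. Qed.

Variables (M : bimodType B A) (N : bimodType A C).

Definition trscale (x : M ⊗ N) (c : C) : M ⊗ N := tmap id (fun n => n *:> c) x.

Lemma rlin_id (P : bimodType B A) : rlin (id : P -> P).
Proof. by []. Qed.
Lemma llin_id (P : lmodType A) : llin (id : P -> P).
Proof. by []. Qed.
Lemma llin_rscale c : llin (fun n : N => n *:> c).
Proof. by split=> [x y|a x]; rewrite ?rscaleDl ?rscaleAl. Qed.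

Lemma trscale_pure m n c : trscale (tpure m n) c = tpure m (n *:> c).
Proof. by rewrite /trscale tmap_pure //; exact: llin_rscale. Qed.
Lemma trscaleDl x y c : trscale (x + y) c = trscale x c + trscale y c.
Proof. by rewrite /trscale tmapD //; exact: llin_rscale. Qed.
Fact trscaleDr x c d : trscale x (c + d) = trscale x c + trscale x d.
Proof.
move: x; apply: tens_ext => [x y|x y|m n]; rewrite ?trscaleDl //.
  by rewrite addrACA.
by rewrite !trscale_pure rscaleDr tpureDr.
Qed.
Fact trscaleA x c d : trscale x (c * d) = trscale (trscale x c) d.
Proof.
move: x; apply: tens_ext => [x y|x y|m n]; rewrite ?trscaleDl //.
by rewrite !trscale_pure rscaleA.
Qed.
Fact trscale1 x : trscale x 1 = x.
Proof.
move: x; apply: tens_ext => [x y|x y|m n]; rewrite ?trscaleDl //.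
by rewrite !trscale_pure rscale1.
Qed.
Fact trscaleAl (b : B) x c : trscale (b *: x) c = b *: trscale x c.
Proof.
move: x; apply: tens_ext => [x y|x y|m n]; rewrite ?(trscaleDl, scalerDr) //.
by rewrite !(trscale_pure, scale_pure).
Qed.
Fact tscale_central (c : k) x : (c%:A : B) *: (x : M ⊗ N) = trscale x c%:A.
Proof.
move: x; apply: tens_ext => [x y|x y|m n]; rewrite ?(trscaleDl, scalerDr) //.
by rewrite scale_pure trscale_pure -!scale_central -tpureA scale_central.
Qed.
HB.instance Definition _ := Lmodule_isBimodule.Build k B C (M ⊗ N)
  trscaleDl trscaleDr trscaleA trscale1 trscaleAl tscale_central.

Lemma rscale_pure m n (c : C) : tpure m n *:> c = tpure m (n *:> c).
Proof. exact: trscale_pure. Qed.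
End TensorMap.

Section Assoc.
Variables (k : fieldType) (C B A : algType k).
Variables (L : bimodType C B) (M : bimodType B A) (E : lmodType A).

Definition tassoc : (L ⊗ M) ⊗ E -> L ⊗ (M ⊗ E) :=
  tlift (fun (x : L ⊗ M) (e : E) =>
    tlift (fun (l : L) (m : M) => tpure l (tpure m e)) x).
Definition tassocV : L ⊗ (M ⊗ E) -> (L ⊗ M) ⊗ E :=
  tlift (fun (l : L) (y : M ⊗ E) =>
    tlift (fun (m : M) (e : E) => tpure (tpure l m) e) y).

Fact balanced_assoc1 (e : E) :
  balanced (fun (l : L) (m : M) => tpure l (tpure m e)).
Proof.
split=> [m x y|l x y|l b m].
- exact: tpureDl.
- by rewrite tpureDl tpureDr.
- by rewrite tpureA scale_pure.
Qed.
Fact balanced_assoc :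
  balanced (fun x (e : E) => tlift (fun (l : L) (m : M) => tpure l (tpure m e)) x).
Proof.
split=> [e|x e f|x a e].
- exact/tliftD/balanced_assoc1.
- move: x; apply: tens_ext => [x y|x y|l m]; rewrite ?tliftD //;
    try exact: balanced_assoc1; first by rewrite addrACA.
  by rewrite !tlift_pure ?tpureDr //; exact: balanced_assoc1.
- move: x; apply: tens_ext => [x y|x y|l m];
    rewrite ?rscaleDl ?tliftD //; try exact: balanced_assoc1.
  by rewrite rscale_pure !tlift_pure ?tpureA //; exact: balanced_assoc1.
Qed.
Fact balanced_assocV1 (l : L) :
  balanced (fun (m : M) (e : E) => tpure (tpure l m : L ⊗ M) e).
Proof.
split=> [e x y|m x y|m a e].
- by rewrite tpureDr tpureDl.
- exact: tpureDr.
- by rewrite -rscale_pure tpureA.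
Qed.
Fact balanced_assocV :
  balanced (fun (l : L) y => tlift (fun (m : M) (e : E) => tpure (tpure l m : L ⊗ M) e) y).
Proof.
split=> [y l m|l|l b y].
- move: y; apply: tens_ext => [x y|x y|n e]; rewrite ?tliftD //;
    try exact: balanced_assocV1; first by rewrite addrACA.
  by rewrite !tlift_pure ?tpureDl //; exact: balanced_assocV1.
- exact/tliftD/balanced_assocV1.
- move: y; apply: tens_ext => [x y|x y|n e];
    rewrite ?scalerDr ?tliftD //; try exact: balanced_assocV1.
  by rewrite scale_pure !tlift_pure ?tpureA //; exact: balanced_assocV1.
Qed.

Lemma tassoc_pure l m e : tassoc (tpure (tpure l m) e) = tpure l (tpure m e).
Proof.
rewrite /tassoc tlift_pure; last exact: balanced_assoc.
by rewrite tlift_pure //; exact: balanced_assoc1.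
Qed.
Lemma tassocV_pure l m e : tassocV (tpure l (tpure m e)) = tpure (tpure l m) e.
Proof.
rewrite /tassocV tlift_pure; last exact: balanced_assocV.
by rewrite tlift_pure //; exact: balanced_assocV1.
Qed.
Lemma tassocD : {morph tassoc : x y / x + y}.
Proof. exact/tliftD/balanced_assoc. Qed.
Lemma tassocVD : {morph tassocV : x y / x + y}.
Proof. exact/tliftD/balanced_assocV. Qed.
End Assoc.

Section TensorLinear.
Variables (k : fieldType) (C B A : algType k).

Lemma tmapZ (M M' : bimodType B A) (E E' : lmodType A) (f : M -> M')
    (g : E -> E') : rlin f -> llin f -> llin g ->
  forall (b : B) x, tmap f g (b *: x) = b *: tmap f g x.
Proof.
move=> f1 f2 hg b; apply: tens_ext => [x y|x y|m e];
  rewrite ?scalerDr ?tmapD ?scalerDr //.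
by rewrite scale_pure !tmap_pure // scale_pure; case: f2 => _ ->.
Qed.
Lemma tassocZ (L : bimodType C B) (M : bimodType B A) (E : lmodType A) (c : C)
    (x : (L ⊗ M) ⊗ E) : tassoc (c *: x) = c *: tassoc x.
Proof.
move: x; apply: tens_ext => [x y|x y|x e]; rewrite ?scalerDr ?tassocD ?scalerDr //.
move: x; apply: tens_ext => [x y|x y|l m];
  rewrite ?scale_pure ?tpureDl ?scalerDr ?tpureDl ?tassocD ?scalerDr //.
by rewrite !tassoc_pure scale_pure.
Qed.
Lemma tassocVZ (L : bimodType C B) (M : bimodType B A) (E : lmodType A) (c : C)
    (x : L ⊗ (M ⊗ E)) : tassocV (c *: x) = c *: tassocV x.
Proof.
move: x; apply: tens_ext => [x y|x y|l x]; rewrite ?scalerDr ?tassocVD ?scalerDr //.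
move: x; apply: tens_ext => [x y|x y|m e];
  rewrite ?scale_pure ?tpureDr ?tassocVD ?scalerDr //.
by rewrite !tassocV_pure !scale_pure.
Qed.
End TensorLinear.

(* The component of degree 0 is A itself; W n is the component of degree n+1. *)
Definition forms (k : fieldType) (A : algType k) (W : nat -> bimodType A A)
    (p : nat) : bimodType A A :=
  if p is q.+1 then W q else A^o.

Definition fcast (k : fieldType) (A : algType k) (W : nat -> bimodType A A)
    (p q : nat) (e : p = q) (x : forms W p) : forms W q :=
  ecast n (forms W n) e x.

(* A differential graded algebra whose component of degree 0 is A; wedge0l and
   wedge0r say that A acts on each component by multiplication in degree 0. *)
Record calculus (k : fieldType) (A : algType k) := Calculus {
  posforms : nat -> bimodType A A;
  wedge : forall p q,
    forms posforms p -> forms posforms q -> forms posforms (p + q);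
  dext : forall p, forms posforms p -> forms posforms p.+1;
  wedgeDl : forall p q (y : forms posforms q),
    {morph (fun x : forms posforms p => wedge x y) : x x' / x + x'};
  wedgeDr : forall p q (x : forms posforms p),
    {morph (fun y : forms posforms q => wedge x y) : y y' / y + y'};
  wedge0l : forall q (a : A) (y : forms posforms q), @wedge 0 q a y = a *: y;
  wedge0r : forall p (x : forms posforms p) (a : A),
    fcast (addn0 p) (@wedge p 0 x a) = x *:> a;
  wedgeA : forall p q r (x : forms posforms p) (y : forms posforms q)
      (z : forms posforms r),
    fcast (addnA p q r) (wedge x (wedge y z)) = wedge (wedge x y) z;
  dextD : forall p, {morph @dext p : x y / x + y};
  dextZ : forall p (c : k) (x : forms posforms p),
    dext ((c%:A : A) *: x) = (c%:A : A) *: dext x;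
  dextK : forall p (x : forms posforms p), dext (dext x) = 0;
  dext_leibniz : forall p q (x : forms posforms p) (y : forms posforms q),
    dext (wedge x y) =
    wedge (dext x) y + (-1) ^+ p *: fcast (addnS p q) (wedge x (dext y))
}.

Definition Om (k : fieldType) (A : algType k) (OA : calculus A) (p : nat) :
  bimodType A A := forms (posforms OA) p.

Definition d0 (k : fieldType) (A : algType k) (OA : calculus A) (a : A) :
  Om OA 1 := @dext k A OA 0 a.
Definition d1 (k : fieldType) (A : algType k) (OA : calculus A) (w : Om OA 1) :
  Om OA 2 := @dext k A OA 1 w.
Definition wedge11 (k : fieldType) (A : algType k) (OA : calculus A)
  (w v : Om OA 1) : Om OA 2 := @wedge k A OA 1 1 w v.

(* Omega^1 A = A.dA, the usual standing convention for differential calculi.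
   It is kept apart from [calculus] because it is needed only for A.  It cannot
   be dropped from the flatness of pushforwards: let A = B = M = k with trivial
   connection on M, Omega A = k[w]/(w^2) with d = 0, and Omega B spanned by
   1, v, dv with all products of positive degree 0; sigma(w) = v is a flat
   bimodule structure with sigma2 = 0, and (k, e |-> w ⊗ e) is flat, but its
   image has curvature dv <> 0. *)
Definition one_forms_generated (k : fieldType) (A : algType k)
    (OA : calculus A) : Prop :=
  forall w : Om OA 1,
    exists s : seq (A * A), w = \sum_(p <- s) p.1 *: d0 OA p.2.

Section CalculusFacts.
Variables (k : fieldType) (A : algType k) (OA : calculus A).

Lemma fcast_id p (e : p = p) (x : Om OA p) : fcast e x = x.
Proof. by rewrite (eq_axiomK e). Qed.

Lemma wedge11Dl (v : Om OA 1) : {morph (fun w => wedge11 w v) : x y / x + y}.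
Proof. exact: wedgeDl. Qed.
Lemma wedge11Dr (w : Om OA 1) : {morph wedge11 w : x y / x + y}.
Proof. by move=> x y; rewrite /wedge11 -[RHS](@wedgeDr k A OA 1 1 w). Qed.
Lemma wedge11A (w v : Om OA 1) (a : A) :
  wedge11 (w *:> a) v = wedge11 w (a *: v).
Proof.
have := @wedgeA k A OA 1 0 1 w a v; rewrite wedge0l (fcast_id (p := 2)) => h.
apply: etrans _ (esym h); congr (@wedge k A OA 1 1 _ _).
by rewrite -(wedge0r w a) (fcast_id (p := 1)).
Qed.
Lemma wedge11Zl (a : A) (w v : Om OA 1) :
  wedge11 (a *: w) v = a *: wedge11 w v.
Proof.
have := @wedgeA k A OA 0 1 1 a w v.
by rewrite (fcast_id (p := 2)) !wedge0l => h; exact: esym h.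
Qed.
Lemma wedge11Zr (w v : Om OA 1) (a : A) :
  wedge11 w (v *:> a) = wedge11 w v *:> a.
Proof.
have := @wedgeA k A OA 1 1 0 w v a; rewrite (fcast_id (p := 2)).
rewrite -(wedge0r v a) -(wedge0r (wedge11 w v : Om OA 2) a).
by rewrite (fcast_id (p := 2)) (fcast_id (p := 1)).
Qed.
Lemma balanced_wedge11 : balanced (@wedge11 k A OA).
Proof. by split; [exact: wedge11Dl|exact: wedge11Dr|by move=> w a v; exact: wedge11A]. Qed.
Lemma wedge11_rlin (w : Om OA 1) : rlin (wedge11 w).
Proof. by split=> [|v a]; [exact: wedge11Dr | exact: wedge11Zr]. Qed.

Lemma d0M (a b : A) : d0 OA (a * b) = d0 OA a *:> b + a *: d0 OA b.
Proof.
have := @dext_leibniz k A OA 0 0 a b; rewrite (fcast_id (p := 1)) expr0 scale1r.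
rewrite !wedge0l -(wedge0r (d0 OA a) b) (fcast_id (p := 1)); exact.
Qed.
Lemma d0D : {morph d0 OA : a b / a + b}.
Proof. by move=> a b; exact: (@dextD k A OA 0 a b). Qed.
Lemma d1D : {morph d1 (OA := OA) : a b / a + b}.
Proof. by move=> v w; exact: (@dextD k A OA 1 v w). Qed.
Lemma d1Zr (w : Om OA 1) (a : A) :
  d1 (w *:> a) = d1 w *:> a - wedge11 w (d0 OA a).
Proof.
have := @dext_leibniz k A OA 1 0 w a; rewrite (fcast_id (p := 2)) expr1 scaleN1r.
rewrite -(wedge0r w a) (fcast_id (p := 1)) /d1 => ->.
by rewrite -(wedge0r (d1 w : Om OA 2) a) (fcast_id (p := 2)).
Qed.
Lemma d1Zl (a : A) (w : Om OA 1) :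
  d1 (a *: w) = wedge11 (d0 OA a) w + a *: d1 w.
Proof.
have := @dext_leibniz k A OA 0 1 a w; rewrite (fcast_id (p := 2)) expr0 scale1r.
by rewrite !wedge0l.
Qed.
End CalculusFacts.

Section Connections.
Variables (k : fieldType) (A : algType k) (OA : calculus A).

(* A left A-module is a k-vector space through c |-> c%:A. *)
Definition is_connection (E : lmodType A) (nabla : E -> Om OA 1 ⊗ E) : Prop :=
  [/\ {morph nabla : x y / x + y},
      forall (c : k) e, nabla ((c%:A : A) *: e) = (c%:A : A) *: nabla e &
      forall (a : A) e, nabla (a *: e) = tpure (d0 OA a) e + a *: nabla e].

(* w ⊗ e |-> dw ⊗ e - w /\ nabla e *)
Definition nabla1 (E : lmodType A) (nabla : E -> Om OA 1 ⊗ E) :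
    Om OA 1 ⊗ E -> Om OA 2 ⊗ E :=
  tlift (fun (w : Om OA 1) (e : E) =>
    tpure (d1 w) e - tmap (wedge11 w) id (nabla e)).

Definition flat_connection (E : lmodType A) (nabla : E -> Om OA 1 ⊗ E) : Prop :=
  forall e, nabla1 nabla (nabla e) = 0.

Lemma balanced_nabla1 (E : lmodType A) (nabla : E -> Om OA 1 ⊗ E) :
  is_connection nabla ->
  balanced (fun (w : Om OA 1) (e : E) =>
    tpure (d1 w) e - tmap (wedge11 w) id (nabla e)).
Proof.
case=> nD _ nL.
have wD v : {morph tmap (wedge11 v) (id : E -> E) : x y / x + y}.
  by apply: tmapD; [exact: wedge11_rlin | exact: llin_id].
split=> [e w v|w e f|w a e].
- rewrite d1D tpureDl addrACA -opprD; congr (_ - _).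
  move: (nabla e); apply: tens_ext => [x y|x y|v' f].
  + by rewrite wD.
  + by rewrite !wD addrACA.
  by rewrite !tmap_pure ?wedge11Dl ?tpureDl //; exact: wedge11_rlin.
- by rewrite nD wD tpureDr addrACA opprD.
rewrite nL wD d1Zr tpureDl -tpureA tmap_pure; [|exact: wedge11_rlin|exact: llin_id].
rewrite opprD addrA.
have -> : tpure (- wedge11 w (d0 OA a)) e = - tpure (wedge11 w (d0 OA a)) e.
  by rewrite (balancedNl _ _ (balanced_pure _ _)).
congr (_ - _); move: (nabla e); apply: tens_ext => [x y|x y|v f].
- by apply: tmapD; [exact: wedge11_rlin | exact: llin_id].
- by rewrite scalerDr wD.
rewrite scale_pure !tmap_pure ?wedge11A //; exact: wedge11_rlin.
Qed.

Record conn_module := ConnModule {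
  cm_mod :> lmodType A;
  cm_nabla : cm_mod -> Om OA 1 ⊗ cm_mod;
  cm_conn : is_connection cm_nabla
}.

Record conn_hom (E F : conn_module) := ConnHom {
  ch_fun :> E -> F;
  ch_lin : llin ch_fun;
  ch_nabla : forall e, cm_nabla (ch_fun e) = tmap id ch_fun (cm_nabla e)
}.

Lemma conn_hom_eq (E F : conn_module) (f g : conn_hom E F) : f =1 g -> f = g.
Proof.
case: f g => [f fl fn] [g gl gn] /= /funext fg; rewrite fg in fl fn *.
by rewrite (Prop_irrelevance fl gl) (Prop_irrelevance fn gn).
Qed.

Fact conn_id_nabla (E : conn_module) (e : E) : cm_nabla e = tmap id id (cm_nabla e).
Proof.
move: (cm_nabla e); apply: tens_ext => [x y|x y|w f] //; first by rewrite tmapD.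
by rewrite tmap_pure.
Qed.
Definition conn_id (E : conn_module) : conn_hom E E :=
  ConnHom (llin_id E) (@conn_id_nabla E).

Fact llin_comp (E F G : lmodType A) (g : F -> G) (f : E -> F) :
  llin g -> llin f -> llin (g \o f).
Proof. by move=> [g1 g2] [f1 f2]; split=> [x y|a x] /=; rewrite ?f1 ?f2. Qed.
Fact conn_comp_nabla (E F G : conn_module) (g : conn_hom F G) (f : conn_hom E F)
    (e : E) : cm_nabla (g (f e)) = tmap id (g \o f) (cm_nabla e).
Proof.
have gl := ch_lin g; have fl := ch_lin f; have gfl := llin_comp gl fl.
rewrite ch_nabla ch_nabla; move: (cm_nabla e).
by apply: tens_ext => [x y|x y|w x]; rewrite ?tmapD // !tmap_pure.
Qed.
Definition conn_comp (E F G : conn_module) (g : conn_hom F G) (f : conn_hom E F) :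
    conn_hom E G :=
  ConnHom (llin_comp (ch_lin g) (ch_lin f)) (conn_comp_nabla g f).
End Connections.

Record category := Category {
  ob :> Type;
  hom : ob -> ob -> Type;
  cid : forall X, hom X X;
  ccomp : forall X Y Z, hom Y Z -> hom X Y -> hom X Z;
  comp1l : forall X Y (f : hom X Y), ccomp (cid Y) f = f;
  comp1r : forall X Y (f : hom X Y), ccomp f (cid X) = f;
  compA : forall X Y Z T (h : hom Z T) (g : hom Y Z) (f : hom X Y),
    ccomp h (ccomp g f) = ccomp (ccomp h g) f
}.

Record functor (C D : category) := Functor {
  fob :> C -> D;
  fhom : forall X Y : C, hom X Y -> hom (fob X) (fob Y);
  fhom1 : forall X : C, fhom (cid X) = cid (fob X);
  fhom_comp : forall (X Y Z : C) (g : hom Y Z) (f : hom X Y),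
    fhom (ccomp g f) = ccomp (fhom g) (fhom f)
}.

Section CategoryOps.
Variables (C D K : category).

Definition full_sub (P : C -> Prop) : category :=
  @Category {X : C | P X} (fun X Y => hom (sval X) (sval Y))
    (fun X => cid (sval X)) (fun X Y Z g f => ccomp g f)
    (fun X Y f => comp1l f) (fun X Y f => comp1r f)
    (fun X Y Z T h g f => compA h g f).

Definition full_incl (P : C -> Prop) : functor (full_sub P) C :=
  @Functor (full_sub P) C sval (fun X Y f => f)
    (fun X => erefl) (fun X Y Z g f => erefl).

Fact fcomp_hom1 (G : functor D K) (F : functor C D) (X : C) :
  fhom G (fhom F (cid X)) = cid (G (F X)).
Proof. by rewrite !fhom1. Qed.
Fact fcomp_hom_comp (G : functor D K) (F : functor C D) (X Y Z : C)
    (g : hom Y Z) (f : hom X Y) :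
  fhom G (fhom F (ccomp g f)) = ccomp (fhom G (fhom F g)) (fhom G (fhom F f)).
Proof. by rewrite !fhom_comp. Qed.
Definition fcomp (G : functor D K) (F : functor C D) : functor C K :=
  @Functor C K (fun X => G (F X)) (fun X Y f => fhom G (fhom F f))
    (fcomp_hom1 G F) (@fcomp_hom_comp G F).
End CategoryOps.

Section ConnCat.
Variables (k : fieldType) (A : algType k) (OA : calculus A).

Definition conn_cat : category.
Proof.
refine (@Category (conn_module OA) (@conn_hom k A OA) (@conn_id k A OA)
  (@conn_comp k A OA) _ _ _).
- by move=> E F f; apply: conn_hom_eq.
- by move=> E F f; apply: conn_hom_eq.
- by move=> E F G H h g f; apply: conn_hom_eq.
Defined.

Definition flat_module (E : conn_cat) : Prop := flat_connection (cm_nabla (c := E)).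
Definition flat_cat : category := full_sub flat_module.
Definition flat_incl : functor flat_cat conn_cat := full_incl flat_module.
End ConnCat.

Section DiffBimodules.
Variables (k : fieldType) (B A : algType k) (OB : calculus B) (OA : calculus A).

Record diff_bimodule := DiffBimodule {
  db_mod :> bimodType B A;
  db_nabla : db_mod -> Om OB 1 ⊗ db_mod;
  db_sigma : db_mod ⊗ Om OA 1 -> Om OB 1 ⊗ db_mod;
  db_conn : is_connection db_nabla;
  db_sigma_bimod : bimod_map db_sigma;
  db_leibniz : forall m (a : A),
    db_nabla (m *:> a) = db_nabla m *:> a + db_sigma (tpure m (d0 OA a))
}.

Variable M : diff_bimodule.

Definition wedge_tens (C : algType k) (OC : calculus C) :
    Om OC 1 ⊗ Om OC 1 -> Om OC 2 :=
  tlift (@wedge11 k C OC).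

Lemma wedge_tens_pure (C : algType k) (OC : calculus C) (w v : Om OC 1) :
  wedge_tens (tpure w v) = wedge11 w v.
Proof. by rewrite /wedge_tens tlift_pure //; exact: balanced_wedge11. Qed.
Lemma wedge_tens_bimod (C : algType k) (OC : calculus C) :
  bimod_map (@wedge_tens C OC).
Proof.
have wD : {morph @wedge_tens C OC : x y / x + y} by exact/tliftD/balanced_wedge11.
split=> [|b|x a].
- exact: wD.
- apply: tens_ext => [x y|x y|w v]; rewrite ?scalerDr ?wD ?scalerDr //.
  by rewrite scale_pure !wedge_tens_pure wedge11Zl.
- move: x; apply: tens_ext => [x y|x y|w v]; rewrite ?rscaleDl ?wD ?rscaleDl //.
  by rewrite rscale_pure !wedge_tens_pure wedge11Zr.
Qed.

Definition wedge_assoc (E : lmodType B) : Om OB 1 ⊗ (Om OB 1 ⊗ E) -> Om OB 2 ⊗ E :=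
  fun x => tmap (@wedge_tens B OB) id (tassocV x).

Definition flat_diff_bimodule : Prop :=
  flat_connection (db_nabla (d := M)) /\
  exists sigma2 : M ⊗ Om OA 2 -> Om OB 2 ⊗ M,
    bimod_map sigma2 /\
    forall x : (M ⊗ Om OA 1) ⊗ Om OA 1,
      wedge_assoc (tmap id (db_sigma (d := M)) (tassoc (tmap (db_sigma (d := M)) id x)))
      = sigma2 (tmap id (@wedge_tens A OA) (tassoc x)).
End DiffBimodules.

Section Pushforward.
Variables (k : fieldType) (B A : algType k) (OB : calculus B) (OA : calculus A).
Variable M : diff_bimodule OB OA.

Definition push_pre (E : conn_module OA) (m : M) (e : E) : Om OB 1 ⊗ (M ⊗ E) :=
  tassoc (tpure (db_nabla m) e)
  + tassoc (tmap (db_sigma (d := M)) id (tassocV (tpure m (cm_nabla e)))).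

Definition push_nabla (E : conn_module OA) : M ⊗ E -> Om OB 1 ⊗ (M ⊗ E) :=
  tlift (@push_pre E).

Lemma sigma_rlin : rlin (db_sigma (d := M)).
Proof. by case: (db_sigma_bimod M). Qed.
Lemma sigma_llin : llin (db_sigma (d := M)).
Proof. by case: (db_sigma_bimod M). Qed.

Definition sigma_id (E : conn_module OA) (y : M ⊗ (Om OA 1 ⊗ E)) :
    Om OB 1 ⊗ (M ⊗ E) :=
  tassoc (tmap (db_sigma (d := M)) id (tassocV y)).
Lemma sigma_idD (E : conn_module OA) : {morph @sigma_id E : x y / x + y}.
Proof.
by move=> x y; rewrite /sigma_id tassocVD tmapD ?tassocD //; exact: sigma_rlin.
Qed.
Lemma sigma_idZ (E : conn_module OA) (b : B) y :
  @sigma_id E (b *: y) = b *: sigma_id y.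
Proof.
rewrite /sigma_id tassocVZ tmapZ ?tassocZ //; [exact: sigma_rlin|exact: sigma_llin].
Qed.
Lemma sigma_id_pure (E : conn_module OA) m w (e : E) :
  sigma_id (tpure m (tpure w e)) = tassoc (tpure (db_sigma (tpure m w)) e).
Proof. by rewrite /sigma_id tassocV_pure tmap_pure //; exact: sigma_rlin. Qed.

Lemma balanced_push (E : conn_module OA) : balanced (@push_pre E).
Proof.
case: (cm_conn E) => nD nZ nL; case: (db_conn M) => mD mZ mL.
rewrite /push_pre; split=> [e m n|m e f|m a e]; rewrite -!/(sigma_id _).
- by rewrite mD !tpureDl tassocD sigma_idD addrACA.
- by rewrite nD !tpureDr tassocD sigma_idD addrACA.
rewrite db_leibniz nL tpureDl tpureDr tassocD sigma_idD tpureA sigma_id_pure.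
by rewrite tpureA addrA.
Qed.

Lemma push_pure (E : conn_module OA) m (e : E) :
  push_nabla (tpure m e) =
  tassoc (tpure (db_nabla m) e) + sigma_id (tpure m (cm_nabla e)).
Proof. by rewrite /push_nabla tlift_pure //; exact: balanced_push. Qed.
Lemma push_nablaD (E : conn_module OA) : {morph @push_nabla E : x y / x + y}.
Proof. exact/tliftD/balanced_push. Qed.

Fact push_conn (E : conn_module OA) : is_connection (@push_nabla E).
Proof.
case: (db_conn M) => mD mZ mL; split; first exact: push_nablaD.
- move=> c; apply: tens_ext => [x y|x y|m e];
    rewrite ?scalerDr ?push_nablaD ?scalerDr //.
  by rewrite scale_pure !push_pure mZ -!scale_pure tassocZ sigma_idZ scalerDr.
- move=> b; apply: tens_ext => [x y|x y|m e].
  + by rewrite scalerDr push_nablaD.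
  + by rewrite tpureDr push_nablaD scalerDr addrACA.
  rewrite scale_pure !push_pure mL tpureDl tassocD tassoc_pure scalerDr -addrA.
  by rewrite -!scale_pure tassocZ sigma_idZ.
Qed.

Definition push_ob (E : conn_module OA) : conn_module OB :=
  ConnModule (push_conn E).

Fact push_hom_lin (E F : conn_module OA) (f : conn_hom E F) :
  llin (tmap (id : M -> M) f).
Proof.
split; [apply: tmapD | apply: tmapZ] => //; exact: ch_lin.
Qed.
Fact push_hom_nabla (E F : conn_module OA) (f : conn_hom E F) (x : M ⊗ E) :
  push_nabla (tmap (id : M -> M) f x) =
  tmap id (tmap (id : M -> M) f) (push_nabla x).
Proof.
have fl := ch_lin f; have Fl := push_hom_lin f.
have FD : {morph tmap (id : Om OB 1 -> _) (tmap (id : M -> M) f) : x y / x + y}.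
  exact: tmapD.
have h y e : tassoc (tpure y (f e)) =
    tmap id (tmap (id : M -> M) f) (tassoc (tpure y e)) :> Om OB 1 ⊗ (M ⊗ F).
  move: y; apply: tens_ext => [x1 y|x1 y|l m]; rewrite ?tpureDl ?tassocD ?FD //.
  by rewrite !tassoc_pure !tmap_pure.
move: x; apply: tens_ext => [x y|x y|m e].
- by rewrite tmapD // push_nablaD.
- by rewrite push_nablaD FD.
rewrite tmap_pure // !push_pure FD h; congr (_ + _).
rewrite ch_nabla; move: (cm_nabla e); apply: tens_ext => [x y|x y|w x].
- by rewrite tmapD // tpureDr sigma_idD.
- by rewrite tpureDr sigma_idD FD.
by rewrite tmap_pure // !sigma_id_pure h.
Qed.
Definition push_hom (E F : conn_module OA) (f : conn_hom E F) :
    conn_hom (push_ob E) (push_ob F) :=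
  @ConnHom k B OB (push_ob E) (push_ob F) _ (push_hom_lin f) (push_hom_nabla f).

Definition push_functor : functor (conn_cat OA) (conn_cat OB).
Proof.
refine (@Functor (conn_cat OA) (conn_cat OB) push_ob push_hom _ _).
- move=> E; apply: conn_hom_eq; apply: tens_ext => // [x y|m e] /=.
    by rewrite tmapD.
  by rewrite tmap_pure.
- move=> E F G g f; apply: conn_hom_eq.
  have fl := ch_lin f; have gl := ch_lin g; have gfl := llin_comp gl fl.
  apply: tens_ext => [x y|x y|m e] /=; rewrite ?tmapD //=.
  by rewrite !tmap_pure //=.
Defined.
End Pushforward.

(* Main.v *)
Require Import Defs.
From mathcomp Require Import all_boot all_order all_algebra.
From mathcomp Require Import boolp.

(** Write D for the extension of a connection to 1-forms ([nabla1]), so that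
    flatness reads D nabla = 0, and write x /\ sigma(w) in Omega^2 B ⊗ M for the
    form part of x in Omega^1 B ⊗ M wedged with sigma(m ⊗ w), m being the module
    part of x ([wedge_sigma]).

    The heart of the proof is the formula ([nabla1_sigma])
      D (sigma (m ⊗ w)) = sigma2 (m ⊗ dw) + (nabla m) /\ sigma(w),
    which says that sigma intertwines the differentials as it should.  On exact
    forms w = db it comes from expanding 0 = D nabla (m.b) with the Leibniz rules
    of nabla and of D on the right.  Replacing m by m.a and expanding nabla (m.a)
    yields it for w = a.db: the new term sigma (m ⊗ da) /\ sigma(db) is
    sigma2 (m ⊗ (da /\ db)) by condition (b), that is, by the compatibility of
    sigma and sigma2 with products, and d(a.db) = da /\ db.  Such forms span
    Omega^1 A by assumption.

    Let D' extend the pushed forward connection nabla' on M ⊗ E.  Unfolding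
    definitions gives, for x in Omega^1 B ⊗ M and y in Omega^1 A ⊗ E,
      D' (x ⊗ e)      = D x ⊗ e - x /\ sigma(nabla e)       ([nabla1_push_tassoc]),
      D' (sigma(m, y)) = sigma2 (m, D y) + nabla m /\ sigma(y) ([nabla1_push_sigma]),
    the second one by the formula above and condition (b) again.  For x = nabla m
    and y = nabla e the mixed terms cancel in the sum, and what remains are the
    curvatures of M and of E:
      D' nabla' (m ⊗ e) = D nabla m ⊗ e + sigma2 (m, D nabla e) = 0.
    Since flat modules form full subcategories, this statement about objects is
    all that is needed to restrict the functor. *)

Set Implicit Arguments.
Unset Strict Implicit.
Unset Printing Implicit Defensive.

Import GRing.Theory.
Local Open Scope ring_scope.

(** * Wedging a form into the first tensor factor *)

Section WedgeLeft.
Variables (k : fieldType) (B : algType k) (OB : calculus B).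

Definition wedgel (E : lmodType B) (v : Om OB 1) :
    Om OB 1 ⊗ E -> Om OB 2 ⊗ E := tmap (wedge11 v) id.

Lemma wedgel_pure (E : lmodType B) v w (e : E) :
  wedgel v (tpure w e) = tpure (wedge11 v w) e.
Proof. by rewrite /wedgel tmap_pure //; exact: wedge11_rlin. Qed.

Lemma wedgelD (E : lmodType B) v : {morph @wedgel E v : x y / x + y}.
Proof. by apply: tmapD => //; exact: wedge11_rlin. Qed.

Lemma wedge_tens_rlin : rlin (@wedge_tens k B OB).
Proof. by case: (wedge_tens_bimod OB). Qed.

Lemma wedge_assocD (E : lmodType B) : {morph @wedge_assoc k B OB E : x y / x + y}.
Proof.
by move=> x y; rewrite /wedge_assoc tassocVD tmapD //; exact: wedge_tens_rlin.
Qed.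

(** Identifies the uncurried product of condition (b) with [wedgel], the form in
    which the product enters [nabla1]. *)
Lemma wedge_assoc_pure (E : lmodType B) v (y : Om OB 1 ⊗ E) :
  wedge_assoc (tpure v y) = wedgel v y.
Proof.
move: y; apply: tens_ext => [x y|x y|w e]; first by rewrite tpureDr wedge_assocD.
  exact: wedgelD.
rewrite wedgel_pure /wedge_assoc tassocV_pure tmap_pure ?wedge_tens_pure //.
exact: wedge_tens_rlin.
Qed.

Lemma nabla1_pure (E : lmodType B) (nabla : E -> Om OB 1 ⊗ E) w e :
  is_connection nabla ->
  nabla1 nabla (tpure w e) = tpure (d1 w) e - wedgel w (nabla e).
Proof. by move=> c; rewrite /nabla1 tlift_pure //; exact: balanced_nabla1. Qed.

Lemma nabla1D (E : lmodType B) (nabla : E -> Om OB 1 ⊗ E) :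
  is_connection nabla -> {morph nabla1 nabla : x y / x + y}.
Proof. by move=> c; apply/tliftD/balanced_nabla1. Qed.
End WedgeLeft.

Lemma wedgel_tassoc (k : fieldType) (B A : algType k) (OB : calculus B)
    (M : bimodType B A) (E : lmodType A) (v : Om OB 1) (x : Om OB 1 ⊗ M) (e : E) :
  wedgel v (tassoc (tpure x e)) = tassoc (tpure (wedgel v x) e).
Proof.
move: x; apply: tens_ext => [x y|x y|w m].
- by rewrite tpureDl tassocD wedgelD.
- by rewrite wedgelD tpureDl tassocD.
by rewrite tassoc_pure !wedgel_pure tassoc_pure.
Qed.

Lemma wedgelZr (k : fieldType) (B A : algType k) (OB : calculus B)
    (M : bimodType B A) (v : Om OB 1) (x : Om OB 1 ⊗ M) (a : A) :
  wedgel v (x *:> a) = wedgel v x *:> a.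
Proof.
move: x; apply: tens_ext => [x y|x y|w m].
- by rewrite rscaleDl wedgelD.
- by rewrite wedgelD rscaleDl.
by rewrite rscale_pure !wedgel_pure rscale_pure.
Qed.

(** * Curvature of a differentiable bimodule *)

Section Curvature.
Variables (k : fieldType) (B A : algType k) (OB : calculus B) (OA : calculus A).
Variable M : diff_bimodule OB OA.

Local Notation sigma := (db_sigma (d := M)).
Local Notation nablaM := (db_nabla (d := M)).

(** The composite (id /\ sigma) of condition (b) as a biadditive function: it
    sends v ⊗ m and w to v /\ sigma (m ⊗ w). *)
Definition wedge_sigma (x : Om OB 1 ⊗ M) (w : Om OA 1) : Om OB 2 ⊗ M :=
  wedge_assoc (tmap id sigma (tassoc (tpure x w))).

Lemma tmap_sigmaD :
  {morph tmap (id : Om OB 1 -> Om OB 1) sigma : x y / x + y}.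
Proof. by apply: tmapD => //; exact: sigma_llin. Qed.

Lemma wedge_sigmaDl w : {morph wedge_sigma^~ w : x y / x + y}.
Proof.
by move=> x y; rewrite /wedge_sigma tpureDl tassocD tmap_sigmaD wedge_assocD.
Qed.

Lemma wedge_sigmaDr x : {morph wedge_sigma x : v w / v + w}.
Proof.
by move=> v w; rewrite /wedge_sigma tpureDr tassocD tmap_sigmaD wedge_assocD.
Qed.

Lemma wedge_sigmaA x a w : wedge_sigma (x *:> a) w = wedge_sigma x (a *: w).
Proof. by rewrite /wedge_sigma tpureA. Qed.

Lemma wedge_sigma_pure v m w :
  wedge_sigma (tpure v m) w = wedgel v (sigma (tpure m w)).
Proof.
rewrite /wedge_sigma tassoc_pure tmap_pure ?wedge_assoc_pure //.
exact: sigma_llin.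
Qed.

Lemma wedge_sigmaZr x w a : wedge_sigma x (w *:> a) = wedge_sigma x w *:> a.
Proof.
have [_ _ sZ] := db_sigma_bimod M.
move: x; apply: tens_ext => [x y|x y|v m].
- exact: wedge_sigmaDl.
- by rewrite wedge_sigmaDl rscaleDl.
by rewrite !wedge_sigma_pure -rscale_pure sZ wedgelZr.
Qed.

(** D satisfies a Leibniz rule on the right because nabla does; the sign is that
    of moving d past a 1-form. *)
Lemma nabla1_rscale (x : Om OB 1 ⊗ M) (a : A) :
  nabla1 nablaM (x *:> a) = nabla1 nablaM x *:> a - wedge_sigma x (d0 OA a).
Proof.
have cM := db_conn M; move: x; apply: tens_ext => [x y|x y|v m].
- by rewrite rscaleDl nabla1D.
- by rewrite nabla1D // rscaleDl wedge_sigmaDl opprD addrACA.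
rewrite rscale_pure !nabla1_pure // db_leibniz wedgelD wedgelZr wedge_sigma_pure.
have -> : (tpure (d1 v) m - wedgel v (nablaM m)) *:> a =
    tpure (d1 v) (m *:> a) - wedgel v (nablaM m) *:> a.
  have rD : {morph (fun z : Om OB 2 ⊗ M => z *:> a) : y z / y + z}.
    by move=> y z; exact: rscaleDl.
  by rewrite rD (morphDN rD) rscale_pure.
by rewrite opprD addrA.
Qed.

Section Flat.
Hypothesis flatM : flat_connection nablaM.
Variable sigma2 : M ⊗ Om OA 2 -> Om OB 2 ⊗ M.
Hypothesis sigma2_bimod : bimod_map sigma2.
Hypothesis sigma2_wedge : forall x : (M ⊗ Om OA 1) ⊗ Om OA 1,
  wedge_assoc (tmap id sigma (tassoc (tmap sigma id x)))
  = sigma2 (tmap id (@wedge_tens k A OA) (tassoc x)).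

Lemma wedge_sigma_sigma m v w :
  wedge_sigma (sigma (tpure m v)) w = sigma2 (tpure m (wedge11 v w)).
Proof.
have := sigma2_wedge (tpure (tpure m v) w).
rewrite tmap_pure //; last exact: sigma_rlin.
rewrite tassoc_pure tmap_pure ?wedge_tens_pure //.
have [wD wZ _] := wedge_tens_bimod OA; by split.
Qed.

(** Both sides of 0 = D nabla (m.a) are expanded by the right Leibniz rules;
    the term (D nabla m).a vanishes, and the other two must then agree. *)
Lemma nabla1_sigma_exact m (a : A) :
  nabla1 nablaM (sigma (tpure m (d0 OA a))) = wedge_sigma (nablaM m) (d0 OA a).
Proof.
have := flatM (m *:> a); rewrite db_leibniz nabla1D; last exact: db_conn.
rewrite nabla1_rscale flatM.
have -> : (0 : Om OB 2 ⊗ M) *:> a = 0.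
  exact: (morphD0 (f := fun z : Om OB 2 ⊗ M => z *:> a) (fun y z => rscaleDl y z a)).
by rewrite sub0r addrC => /subr0_eq.
Qed.

(** Both sides are additive in w, so it suffices to take w = a.db; there m ⊗ a.db
    is m.a ⊗ db, to which the exact case applies. *)
Lemma nabla1_sigma : one_forms_generated OA -> forall m w,
  nabla1 nablaM (sigma (tpure m w)) =
  sigma2 (tpure m (d1 w)) + wedge_sigma (nablaM m) w.
Proof.
move=> gen m w; have [sD sZl sZr] := db_sigma_bimod M.
have [s2D _ _] := sigma2_bimod.
pose L (w : Om OA 1) := nabla1 nablaM (sigma (tpure m w)).
pose R (w : Om OA 1) := sigma2 (tpure m (d1 w)) + wedge_sigma (nablaM m) w.
have LD : {morph L : x y / x + y}.
  by move=> x y; rewrite /L tpureDr sD nabla1D //; exact: db_conn.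
have RD : {morph R : x y / x + y}.
  by move=> x y; rewrite /R d1D tpureDr s2D wedge_sigmaDr addrACA.
rewrite -/(L w) -/(R w); case: (gen w) => s ->.
rewrite (big_morph L LD (morphD0 LD)) (big_morph R RD (morphD0 RD)).
apply: eq_bigr => -[a b] _ /=; rewrite /L /R.
rewrite -tpureA nabla1_sigma_exact db_leibniz wedge_sigmaDl addrC.
have -> : d1 (a *: d0 OA b) = wedge11 (d0 OA a) (d0 OA b).
  rewrite d1Zl; have -> : d1 (d0 OA b) = 0 by exact: (@dextK k A OA 0 b).
  by rewrite scaler0 addr0.
by rewrite wedge_sigmaA wedge_sigma_sigma.
Qed.

(** * Curvature of the pushforward *)

Section Push.
Variable E : conn_module OA.
Local Notation nablaE := (cm_nabla (c := E)).
Local Notation pushE := (@push_nabla k B A OB OA M E).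

(** [wedge_sigma] and sigma2 with the module E carried along as a last factor. *)
Definition wedge_sigma_id (x : Om OB 1 ⊗ M) : Om OA 1 ⊗ E -> Om OB 2 ⊗ (M ⊗ E) :=
  tlift (fun w e => tassoc (tpure (wedge_sigma x w) e)).

Definition sigma2_id (m : M) : Om OA 2 ⊗ E -> Om OB 2 ⊗ (M ⊗ E) :=
  tlift (fun v e => tassoc (tpure (sigma2 (tpure m v)) e)).

Lemma balanced_wedge_sigma_id x :
  balanced (fun w (e : E) => tassoc (tpure (wedge_sigma x w) e)).
Proof.
split=> [e v w|w e f|w a e].
- by rewrite wedge_sigmaDr tpureDl tassocD.
- by rewrite tpureDr tassocD.
by rewrite wedge_sigmaZr tpureA.
Qed.

Lemma wedge_sigma_id_pure x w e :
  wedge_sigma_id x (tpure w e) = tassoc (tpure (wedge_sigma x w) e).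
Proof. by rewrite /wedge_sigma_id tlift_pure //; exact: balanced_wedge_sigma_id. Qed.

Lemma wedge_sigma_idDr x : {morph wedge_sigma_id x : y z / y + z}.
Proof. exact/tliftD/balanced_wedge_sigma_id. Qed.

Lemma wedge_sigma_idDl y : {morph wedge_sigma_id^~ y : x z / x + z}.
Proof.
move=> x z; move: y; apply: tens_ext => [y1 y2|y1 y2|w e].
- exact: wedge_sigma_idDr.
- by rewrite !wedge_sigma_idDr addrACA.
by rewrite !wedge_sigma_id_pure wedge_sigmaDl tpureDl tassocD.
Qed.

Lemma balanced_sigma2_id m :
  balanced (fun v (e : E) => tassoc (tpure (sigma2 (tpure m v)) e)).
Proof.
have [sD _ sZ] := sigma2_bimod; split=> [e v w|w e f|w a e].
- by rewrite tpureDr sD tpureDl tassocD.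
- by rewrite tpureDr tassocD.
by rewrite -rscale_pure sZ tpureA.
Qed.

Lemma sigma2_id_pure m v e :
  sigma2_id m (tpure v e) = tassoc (tpure (sigma2 (tpure m v)) e).
Proof. by rewrite /sigma2_id tlift_pure //; exact: balanced_sigma2_id. Qed.

Lemma sigma2_idD m : {morph sigma2_id m : y z / y + z}.
Proof. exact/tliftD/balanced_sigma2_id. Qed.

Lemma wedgel_sigma_id v m (y : Om OA 1 ⊗ E) :
  wedgel v (sigma_id (tpure m y)) = wedge_sigma_id (tpure v m) y.
Proof.
move: y; apply: tens_ext => [y z|y z|w e].
- by rewrite tpureDr sigma_idD wedgelD.
- exact: wedge_sigma_idDr.
by rewrite sigma_id_pure wedgel_tassoc wedge_sigma_id_pure wedge_sigma_pure.
Qed.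

Lemma wedge_sigma_id_sigma m w (y : Om OA 1 ⊗ E) :
  wedge_sigma_id (sigma (tpure m w)) y = sigma2_id m (wedgel w y).
Proof.
move: y; apply: tens_ext => [y z|y z|v e].
- exact: wedge_sigma_idDr.
- by rewrite wedgelD sigma2_idD.
by rewrite wedgel_pure sigma2_id_pure wedge_sigma_id_pure wedge_sigma_sigma.
Qed.

Lemma nabla1_push_tassoc x (e : E) :
  nabla1 pushE (tassoc (tpure x e)) =
  tassoc (tpure (nabla1 nablaM x) e) - wedge_sigma_id x (nablaE e).
Proof.
have cP := push_conn M E; have cM := db_conn M.
move: x; apply: tens_ext => [x y|x y|v m].
- by rewrite tpureDl tassocD nabla1D.
- by rewrite nabla1D // tpureDl tassocD wedge_sigma_idDl opprD addrACA.
rewrite tassoc_pure !nabla1_pure // push_pure wedgelD wedgel_tassoc wedgel_sigma_id.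
have tD : {morph (fun z : Om OB 2 ⊗ M => tassoc (tpure z e)) : y z / y + z}.
  by move=> y z; rewrite tpureDl tassocD.
by rewrite tD (morphDN tD) tassoc_pure opprD addrA.
Qed.

(** On y = w ⊗ e, [nabla1_push_tassoc] leaves D (sigma (m ⊗ w)) ⊗ e, which
    [nabla1_sigma] evaluates, and - sigma (m ⊗ w) /\ sigma(nabla e), which
    condition (b) turns into - sigma2 (m ⊗ (w /\ nabla e)): the sigma2 terms
    make up D y. *)
Lemma nabla1_push_sigma : one_forms_generated OA -> forall m (y : Om OA 1 ⊗ E),
  nabla1 pushE (sigma_id (tpure m y)) =
  sigma2_id m (nabla1 nablaE y) + wedge_sigma_id (nablaM m) y.
Proof.
move=> gen m; have cP := push_conn M E; have cE := cm_conn E.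
apply: tens_ext => [y z|y z|w e].
- by rewrite tpureDr sigma_idD nabla1D.
- by rewrite nabla1D // sigma2_idD wedge_sigma_idDr addrACA.
rewrite sigma_id_pure nabla1_push_tassoc nabla1_sigma // wedge_sigma_id_sigma.
rewrite nabla1_pure // sigma2_idD (morphDN (@sigma2_idD m)).
by rewrite tpureDl tassocD sigma2_id_pure wedge_sigma_id_pure addrAC.
Qed.

Lemma push_flat : one_forms_generated OA ->
  flat_connection nablaE -> flat_connection pushE.
Proof.
move=> gen flatE; have cP := push_conn M E.
apply: tens_ext => [x y|x y|m e]; first by rewrite push_nablaD nabla1D.
  by rewrite addr0.
rewrite push_pure nabla1D // nabla1_push_tassoc nabla1_push_sigma // flatM flatE.
have tD : {morph (fun z : Om OB 2 ⊗ M => tassoc (tpure z e)) : y z / y + z}.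
  by move=> y z; rewrite tpureDl tassocD.
by rewrite (morphD0 tD) (morphD0 (@sigma2_idD m)) !add0r addNr.
Qed.
End Push.
End Flat.
End Curvature.

(** * Restriction to full subcategories *)

(** The functor laws are propositions, so functors with the same action on objects
    are equal as soon as they agree on morphisms.  The object part is shared to
    avoid transporting morphisms along equalities of objects. *)
Lemma functor_eq (C D : category) (ob : C -> D)
    (F G : forall X Y : C, Defs.hom X Y -> Defs.hom (ob X) (ob Y)) F1 Fc G1 Gc :
  (forall X Y f, F X Y f = G X Y f) ->
  @Functor C D ob F F1 Fc = @Functor C D ob G G1 Gc.
Proof.
move=> FG; have eqFG : F = G by do 3![apply: functional_extensionality_dep => ?].
case: _ / eqFG in G1 Gc *.
by rewrite (Prop_irrelevance F1 G1) (Prop_irrelevance Fc Gc).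
Qed.

Lemma full_sub_restrict (C D : category) (F : functor C D)
    (P : C -> Prop) (Q : D -> Prop) :
  (forall X, P X -> Q (F X)) ->
  exists G : functor (full_sub P) (full_sub Q),
    fcomp (full_incl Q) G = fcomp F (full_incl P).
Proof.
move=> PQ.
exists (@Functor (full_sub P) (full_sub Q)
  (fun X => exist Q (F (sval X)) (PQ _ (svalP X)))
  (fun X Y f => fhom F f) (fun X => fhom1 F (sval X))
  (fun X Y Z g f => fhom_comp F g f)).
exact: functor_eq.
Qed.

Theorem proposition2p15 (k : fieldType) (A B : algType k)
    (OA : calculus A) (OB : calculus B) (M : diff_bimodule OB OA) :
  one_forms_generated OA ->
  flat_diff_bimodule M ->
  exists G : functor (flat_cat OA) (flat_cat OB),
    fcomp (flat_incl OB) G = fcomp (push_functor M) (flat_incl OA).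
Proof.
move=> gen [flatM [sigma2 [s2b s2w]]]; apply: full_sub_restrict => E flatE.
exact: (push_flat flatM s2b s2w gen flatE).
Qed.
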